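(* Let $n\ge 2$ and $q\in K^*$. The map $\rho$ sending $a_{ij}$ to $a_{n+1-j,\,n+1-i}$ ($1\le i\le j\le n$) defines an automorphism of order $2$ of the algebra $T_q(n)$.
   Context: $K$ is a field of characteristic different from $2$; $K^*=K\setminus\{0\}$. For $n\ge 2$ and $q\in K^*$, $T_q(n)$ is the unital associative $K$-algebra with generators $a_{ij}$, $1\le i\le j\le n$, and defining relations: $a_{jk}a_{ik}=q\,a_{ik}a_{jk}$ for $i<j\le k$; $a_{jk}a_{jl}=q\,a_{jl}a_{jk}$ for $j\le k<l$; $a_{ik}a_{jl}=a_{jl}a_{ik}$ for $i<j\le l$, $i\le k<l$; $a_{jk}a_{il}=q^2a_{il}a_{jk}$ for $i<j\le k<l$. *)

(* Defs.v *)
From HB Require Import structures.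
From mathcomp Require Import all_boot all_algebra.
From mathcomp Require Import boolp.
From mathcomp Require Import finmap monalg.

Set Implicit Arguments.
Unset Strict Implicit.
Unset Printing Implicit Defensive.

Import GRing.Theory.

Local Open Scope ring_scope.
Local Open Scope quotient_scope.

Definition has_order (T : Type) (f : T -> T) (d : nat) : Prop :=
  [/\ (0 < d)%N, iter d f =1 id
    & forall m : nat, (0 < m < d)%N -> ~ iter m f =1 id].

Section TwoSidedIdeal.
Variables (A : nzRingType) (S : A -> A -> Prop).

(* The two-sided ideal generated by the differences x - y with S x y. *)
Inductive ideal_gen : A -> Prop :=
  | ideal_gen_rel x y : S x y -> ideal_gen (x - y)
  | ideal_gen0 : ideal_gen 0
  | ideal_genD x y : ideal_gen x -> ideal_gen y -> ideal_gen (x + y)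
  | ideal_genMl a x : ideal_gen x -> ideal_gen (a * x)
  | ideal_genMr a x : ideal_gen x -> ideal_gen (x * a).

Definition ideal_pred : {pred A} := fun x => `[< ideal_gen x >].

Lemma ideal_predP x : reflect (ideal_gen x) (x \in ideal_pred).
Proof. exact: asboolP. Qed.

Lemma ideal_pred_zmod : zmod_closed ideal_pred.
Proof.
split; first exact/ideal_predP/ideal_gen0.
move=> x y /ideal_predP Ix /ideal_predP Iy; apply/ideal_predP.
by rewrite -mulN1r; apply: ideal_genD => //; apply: ideal_genMl.
Qed.

HB.instance Definition _ :=
  GRing.isZmodClosed.Build A ideal_pred ideal_pred_zmod.

End TwoSidedIdeal.

Section TriangularAlgebra.
Variables (K : fieldType) (n : nat) (q : K).

(* Indices are 0-based: (i, j) : 'I_n * 'I_n stands for a_{i+1,j+1}. *)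
Definition tri_index : Type := {p : 'I_n * 'I_n | (p.1 <= p.2)%N}.
HB.instance Definition _ := Finite.on tri_index.

(* The free unital associative K-algebra on the a_ij: the monoid algebra of the
   free monoid on tri_index. *)
Local Notation tri_free := {malg K[{fmonom tri_index}]}.

Definition tri_var (i j : 'I_n) (le_ij : (i <= j)%N) : tri_free :=
  << fmu (exist (fun p : 'I_n * 'I_n => (p.1 <= p.2)%N) (i, j) le_ij) >>.

Local Notation a := tri_var.

Inductive tri_rel : tri_free -> tri_free -> Prop :=
  | tri_rel_col (i j k : 'I_n) (ik : (i <= k)%N) (jk : (j <= k)%N) :
      (i < j)%N -> tri_rel (a jk * a ik) (q *: (a ik * a jk))
  | tri_rel_row (j k l : 'I_n) (jk : (j <= k)%N) (jl : (j <= l)%N) :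
      (k < l)%N -> tri_rel (a jk * a jl) (q *: (a jl * a jk))
  | tri_rel_comm (i j k l : 'I_n) (ik : (i <= k)%N) (jl : (j <= l)%N) :
      (i < j)%N -> (k < l)%N -> tri_rel (a ik * a jl) (a jl * a ik)
  | tri_rel_cross (i j k l : 'I_n) (jk : (j <= k)%N) (il : (i <= l)%N) :
      (i < j)%N -> (k < l)%N ->
      tri_rel (a jk * a il) (q ^+ 2 *: (a il * a jk)).

Local Notation I := (ideal_pred tri_rel).

Definition tri_alg : Type := {ideal_quot I}.
HB.instance Definition _ := GRing.Zmodule.on tri_alg.

Definition tri_pi (x : tri_free) : tri_alg := \pi_({ideal_quot I}) x.

Definition tri_gen (i j : 'I_n) (le_ij : (i <= j)%N) : tri_alg :=
  tri_pi (a le_ij).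

Lemma tri_pi_surj (x : tri_alg) : exists y, x = tri_pi y.
Proof. by exists (repr (x : {ideal_quot I})); rewrite /tri_pi reprK. Qed.

Lemma tri_pi_eq x y : tri_pi x = tri_pi y <-> ideal_gen tri_rel (x - y).
Proof.
split=> [|Ixy]; first by move/eqP; rewrite -Quotient.idealrBE => /ideal_predP.
by apply/eqP; rewrite -Quotient.idealrBE; apply/ideal_predP.
Qed.

Lemma tri_piB x y : tri_pi (x - y) = tri_pi x - tri_pi y.
Proof. exact: (raddfB (\pi_({ideal_quot I}))). Qed.

Lemma tri_piD x y : tri_pi (x + y) = tri_pi x + tri_pi y.
Proof. exact: (raddfD (\pi_({ideal_quot I}))). Qed.

Definition tri_one : tri_alg := tri_pi 1.
Definition tri_mul (x y : tri_alg) : tri_alg :=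
  tri_pi (repr (x : {ideal_quot I}) * repr (y : {ideal_quot I})).
Definition tri_scale (c : K) (x : tri_alg) : tri_alg :=
  tri_pi (c *: repr (x : {ideal_quot I})).

Lemma tri_repr x : ideal_gen tri_rel (repr (tri_pi x : {ideal_quot I}) - x).
Proof. by apply/tri_pi_eq; rewrite /tri_pi reprK. Qed.

Lemma tri_mulE x y : tri_mul (tri_pi x) (tri_pi y) = tri_pi (x * y).
Proof.
apply/tri_pi_eq; set x' := repr _; set y' := repr _.
have -> : x' * y' - x * y = (x' - x) * y' + x * (y' - y).
  by rewrite mulrBl mulrBr addrA subrK.
by apply: ideal_genD; [apply/ideal_genMr/tri_repr|apply/ideal_genMl/tri_repr].
Qed.

Lemma tri_scaleE c x : tri_scale c (tri_pi x) = tri_pi (c *: x).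
Proof.
apply/tri_pi_eq; rewrite -scalerBr -[X in c *: X]mul1r scalerAl.
exact/ideal_genMl/tri_repr.
Qed.

Lemma tri_free_scalerAr c (x y : tri_free) : c *: (x * y) = x * (c *: y).
Proof.
apply/malgP => k; rewrite mcoeffZ.
rewrite mcoeffMl (mcoeffMlw _ (fsubset_refl _) (msuppZ_le c y)).
rewrite mulr_sumr; apply: eq_bigr => k1 _.
rewrite mulr_sumr; apply: eq_bigr => k2 _.
by rewrite mcoeffZ mulrnAr mulrCA.
Qed.

Fact tri_mulA : associative tri_mul.
Proof.
move=> x y z; have [x' ->] := tri_pi_surj x; have [y' ->] := tri_pi_surj y.
by have [z' ->] := tri_pi_surj z; rewrite !tri_mulE mulrA.
Qed.

Fact tri_mul1 : left_id tri_one tri_mul.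
Proof. by move=> x; have [x' ->] := tri_pi_surj x; rewrite tri_mulE mul1r. Qed.

Fact tri_mulr1 : right_id tri_one tri_mul.
Proof. by move=> x; have [x' ->] := tri_pi_surj x; rewrite tri_mulE mulr1. Qed.

Fact tri_mulDl : left_distributive tri_mul +%R.
Proof.
move=> x y z; have [x' ->] := tri_pi_surj x; have [y' ->] := tri_pi_surj y.
have [z' ->] := tri_pi_surj z.
by rewrite -tri_piD !tri_mulE -tri_piD mulrDl.
Qed.

Fact tri_mulDr : right_distributive tri_mul +%R.
Proof.
move=> x y z; have [x' ->] := tri_pi_surj x; have [y' ->] := tri_pi_surj y.
have [z' ->] := tri_pi_surj z.
by rewrite -tri_piD !tri_mulE -tri_piD mulrDr.
Qed.

(* Every defining relation has zero constant term on both sides, so 1 is not in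
   the ideal. *)
Lemma tri_ideal_coeff1 x : ideal_gen tri_rel x -> x@_(mone : {fmonom _}) = 0.
Proof.
have a1 (i j : 'I_n) (le_ij : (i <= j)%N) : (a le_ij)@_(mone : {fmonom _}) = 0.
  by rewrite mcoeffU1 fmP fmuE fm1.
have M1 (y z : tri_free) : (y * z)@_mone = y@_mone * z@_mone.
  exact: (mcoeff1g_is_multiplicative _ _).1.
elim=> [y z yz||y z _ y0 _ z0|b y _ y0|b y _ y0]; rewrite ?mcoeff0 //.
- have a2 (i j k l : 'I_n) (ij : (i <= j)%N) (kl : (k <= l)%N) :
      (a ij * a kl)@_(mone : {fmonom _}) = 0.
    by rewrite M1 a1 mul0r.
  have a2Z (i j k l : 'I_n) (ij : (i <= j)%N) (kl : (k <= l)%N) c :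
      (c *: (a ij * a kl))@_(mone : {fmonom _}) = 0.
    by rewrite mcoeffZ a2 mulr0.
  rewrite mcoeffB; case: yz => *; rewrite [X in X - _]a2 sub0r.
  + by rewrite a2Z oppr0.
  + by rewrite a2Z oppr0.
  + by rewrite a2 oppr0.
  + by rewrite a2Z oppr0.
- by rewrite mcoeffD y0 z0 addr0.
- by rewrite M1 y0 mulr0.
- by rewrite M1 y0 mul0r.
Qed.

Fact tri_one_neq0 : tri_one != 0.
Proof.
apply/eqP; rewrite -[0](raddf0 (\pi_({ideal_quot I}))) => /tri_pi_eq.
by rewrite subr0 => /tri_ideal_coeff1 /eqP; rewrite mcoeff1 eqxx oner_eq0.
Qed.

HB.instance Definition _ := GRing.Zmodule_isNzRing.Build tri_alg
  tri_mulA tri_mul1 tri_mulr1 tri_mulDl tri_mulDr tri_one_neq0.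

Fact tri_scaleA c d x : tri_scale c (tri_scale d x) = tri_scale (c * d) x.
Proof.
by have [x' ->] := tri_pi_surj x; rewrite !tri_scaleE scalerA.
Qed.

Fact tri_scale1 : left_id 1 tri_scale.
Proof.
by move=> x; have [x' ->] := tri_pi_surj x; rewrite tri_scaleE scale1r.
Qed.

Fact tri_scaleDr : right_distributive tri_scale +%R.
Proof.
move=> c x y; have [x' ->] := tri_pi_surj x; have [y' ->] := tri_pi_surj y.
by rewrite -tri_piD !tri_scaleE -tri_piD scalerDr.
Qed.

Fact tri_scaleDl x : {morph tri_scale^~ x : c d / c + d}.
Proof.
by move=> c d; have [x' ->] := tri_pi_surj x; rewrite !tri_scaleE -tri_piD scalerDl.
Qed.

HB.instance Definition _ := GRing.Zmodule_isLmodule.Build K tri_alg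
  tri_scaleA tri_scale1 tri_scaleDr tri_scaleDl.

Fact tri_scaleAl (c : K) (x y : tri_alg) : c *: (x * y) = (c *: x) * y.
Proof.
have [x' ->] := tri_pi_surj x; have [y' ->] := tri_pi_surj y.
change (tri_scale c (tri_mul (tri_pi x') (tri_pi y'))
  = tri_mul (tri_scale c (tri_pi x')) (tri_pi y')).
by rewrite !(tri_mulE, tri_scaleE) scalerAl.
Qed.

HB.instance Definition _ := GRing.Lmodule_isLalgebra.Build K tri_alg tri_scaleAl.

Fact tri_scaleAr (c : K) (x y : tri_alg) : c *: (x * y) = x * (c *: y).
Proof.
have [x' ->] := tri_pi_surj x; have [y' ->] := tri_pi_surj y.
change (tri_scale c (tri_mul (tri_pi x') (tri_pi y'))
  = tri_mul (tri_pi x') (tri_scale c (tri_pi y'))).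
by rewrite !(tri_mulE, tri_scaleE) tri_free_scalerAr.
Qed.

HB.instance Definition _ := GRing.Lalgebra_isAlgebra.Build K tri_alg tri_scaleAr.

Lemma tri_pi_is_zmod_morphism : zmod_morphism tri_pi.
Proof. exact: tri_piB. Qed.
HB.instance Definition _ :=
  GRing.isZmodMorphism.Build tri_free tri_alg tri_pi tri_pi_is_zmod_morphism.

Lemma tri_pi_is_monoid_morphism : monoid_morphism tri_pi.
Proof. by split=> // x y; rewrite -tri_mulE. Qed.
HB.instance Definition _ :=
  GRing.isMonoidMorphism.Build tri_free tri_alg tri_pi tri_pi_is_monoid_morphism.

Lemma tri_pi_is_scalable : scalable tri_pi.
Proof. by move=> c x; rewrite -tri_scaleE. Qed.
HB.instance Definition _ :=
  GRing.isScalable.Build K tri_free tri_alg *:%R tri_pi tri_pi_is_scalable.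

End TriangularAlgebra.

Lemma rev_ord_le (n : nat) (i j : 'I_n) :
  (i <= j)%N -> (rev_ord j <= rev_ord i)%N.
Proof. by move=> le_ij; apply: leq_sub2l. Qed.

(* Main.v *)
Require Import Defs.
From HB Require Import structures.
From mathcomp Require Import all_boot all_algebra.
From mathcomp Require Import finmap monalg.

Set Implicit Arguments.
Unset Strict Implicit.
Unset Printing Implicit Defensive.

Import GRing.Theory.
Local Open Scope ring_scope.

(* Reversal exchanges the row and the column relations and preserves the two
   other families, so the universal property of T_q(n) yields rho. An
   endomorphism is determined by the generators, whence uniqueness and rho^2 = 1.
   Finally rho is not the identity: every defining relation only involves
   products of two distinct generators, so T_q(n) has a character sending a_11
   to 1 and all other generators to 0; it separates a_11 from rho(a_11) = a_nn. *)

Section FreeAlgebra.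
Variables (K : fieldType) (I : choiceType) (A : algType K).

Section Lift.
Variable v : I -> A.

Definition fmonom_eval (m : {fmonom I}) : A := \prod_(i <- (m : seq I)) v i.

Lemma fmonom_eval_mmorphism : mmorphism fmonom_eval.
Proof.
rewrite /fmonom_eval; split=> [m1 m2|]; first by rewrite fmM big_cat.
by rewrite fm1 big_nil.
Qed.

HB.instance Definition _ :=
  isMultiplicative.Build {fmonom I} A fmonom_eval fmonom_eval_mmorphism.

Definition free_lift : {malg K[{fmonom I}]} -> A :=
  mmap (in_alg A) fmonom_eval.

Lemma free_lift_is_zmod_morphism : zmod_morphism free_lift.
Proof. exact: (mmapB (f := in_alg A)). Qed.
HB.instance Definition _ := GRing.isZmodMorphism.Build
  {malg K[{fmonom I}]} A free_lift free_lift_is_zmod_morphism.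

Lemma free_lift_is_monoid_morphism : monoid_morphism free_lift.
Proof.
have [|M1 M2] :=
    commr_mmap_is_multiplicative (f := in_alg A) (h := fmonom_eval).
  (* Coefficients are sent to multiples of 1, hence to central elements of [A], so they commute with
     every evaluated word. *)
  by move=> g m m'; rewrite /GRing.comm /= mulr_algl mulr_algr.
by split.
Qed.
HB.instance Definition _ := GRing.isMonoidMorphism.Build
  {malg K[{fmonom I}]} A free_lift free_lift_is_monoid_morphism.

Lemma free_lift_is_scalable : scalable free_lift.
Proof. by move=> c x; rewrite /free_lift mmapZ /= mulr_algl. Qed.
HB.instance Definition _ := GRing.isScalable.Build
  K {malg K[{fmonom I}]} A *:%R free_lift free_lift_is_scalable.

Lemma free_liftU i : free_lift << fmu i >> = v i.
Proof.
by rewrite /free_lift mmapU /= scale1r mul1r /fmonom_eval fmU big_seq1.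
Qed.

End Lift.

(** Linearity reduces the claim to single words, and multiplicativity settles these by induction on
    the length. *)
Lemma free_lrmorphism_eq (f g : {lrmorphism {malg K[{fmonom I}]} -> A}) :
  (forall i, f << fmu i >> = g << fmu i >>) -> f =1 g.
Proof.
move=> fg x; rewrite [x]monalgE !raddf_sum; apply: eq_bigr => m _ /=.
have -> : << x@_m *g m >> = x@_m *: << m >>.
  by apply/malgP => k; rewrite mcoeffZ !mcoeffU mulr_natr.
rewrite !linearZ; congr (_ *: _).
case: m => s; elim: s => [|i s IHs].
  have -> : << FMonom [::] >> = 1 :> {malg K[{fmonom I}]}.
    by congr << _ >>; apply/eqP; rewrite fmP fm1.
  by rewrite !rmorph1.
have -> : << FMonom (i :: s) >> = << fmu i >> * << FMonom s >> :>
    {malg K[{fmonom I}]}.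
  rewrite malgM_def fgmulUU mulr1; congr << _ >>.
  by apply/eqP; rewrite fmP fmM fmU.
by rewrite !rmorphM /= fg IHs.
Qed.

End FreeAlgebra.

Section UniversalProperty.
Variables (K : fieldType) (n : nat) (q : K) (A : algType K).
Local Notation tri_free := {malg K[{fmonom (tri_index n)}]}.

(* [free_liftU] does not rewrite [tri_var]: the latter carries the choice
   structure of the underlying sigma type instead of that of [tri_index]. *)
Lemma free_lift_tri_var (v : tri_index n -> A) (i j : 'I_n)
    (le_ij : (i <= j)%N) :
  free_lift v (tri_var K le_ij) =
  v (exist (fun p : 'I_n * 'I_n => (p.1 <= p.2)%N) (i, j) le_ij).
Proof. exact: free_liftU. Qed.

(** The kernel of [free_lift v] is a two-sided ideal; once it contains the defining differences it
    contains all of [ideal_gen], so the lift descends to the quotient. *)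
Lemma tri_alg_lift (v : tri_index n -> A) :
    (forall x y, tri_rel q x y -> free_lift v x = free_lift v y) ->
  exists f : {lrmorphism tri_alg n q -> A},
    forall (i j : 'I_n) (le_ij : (i <= j)%N),
      f (tri_gen q le_ij) =
      v (exist (fun p : 'I_n * 'I_n => (p.1 <= p.2)%N) (i, j) le_ij).
Proof.
move=> F_rel; pose F : {lrmorphism tri_free -> A} := free_lift v.
have F0 x : ideal_gen (tri_rel q) x -> F x = 0.
  elim=> [y z /F_rel e||y z _ y0 _ z0|b y _ y0|b y _ y0].
  - by rewrite rmorphB /= e subrr.
  - exact: rmorph0.
  - by rewrite rmorphD /= y0 z0 addr0.
  - by rewrite rmorphM /= y0 mulr0.
  - by rewrite rmorphM /= y0 mul0r.
(* [f] evaluates [F] at a chosen representative; [fE] shows that the choice is immaterial, since [F]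
   kills the ideal. *)
pose f (x : tri_alg n q) : A :=
  F (generic_quotient.repr (x : Quotient.quot (ideal_pred (tri_rel q)))).
have fE x : f (tri_pi q x) = F x.
  by apply/eqP; rewrite -subr_eq0 -rmorphB; apply/eqP/F0/tri_repr.
have f_zmod : zmod_morphism f.
  move=> x y; have [x' ->] := tri_pi_surj x; have [y' ->] := tri_pi_surj y.
  by rewrite -rmorphB !fE rmorphB.
have f_monoid : monoid_morphism f.
  split=> [|x y]; first by rewrite -(rmorph1 (tri_pi q)) fE rmorph1.
  have [x' ->] := tri_pi_surj x; have [y' ->] := tri_pi_surj y.
  by rewrite -rmorphM !fE rmorphM.
have f_scal : scalable f.
  move=> c x; have [x' ->] := tri_pi_surj x.
  by rewrite -linearZ !fE linearZ.
pose fZ := GRing.isZmodMorphism.Build _ _ f f_zmod.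
pose fM := GRing.isMonoidMorphism.Build _ _ f f_monoid.
pose fS := GRing.isScalable.Build _ _ _ _ f f_scal.
pose fL : {lrmorphism tri_alg n q -> A} := HB.pack f fZ fM fS.
by exists fL => i j le_ij; rewrite -free_lift_tri_var; apply: fE.
Qed.

Lemma tri_lrmorphism_eq (f g : {lrmorphism tri_alg n q -> A}) :
    (forall (i j : 'I_n) (le_ij : (i <= j)%N),
       f (tri_gen q le_ij) = g (tri_gen q le_ij)) ->
  f =1 g.
Proof.
move=> fg x; have [y ->] := tri_pi_surj x.
apply: (free_lrmorphism_eq (f := f \o @tri_pi K n q) (g := g \o @tri_pi K n q)).
by case=> -[i j] le_ij; apply: fg.
Qed.

End UniversalProperty.

Lemma tri_gen_neq (K : fieldType) (n : nat) (q : K)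
    (i j k l : 'I_n) (le_ij : (i <= j)%N) (le_kl : (k <= l)%N) :
  (i, j) != (k, l) -> tri_gen q le_ij != tri_gen q le_kl.
Proof.
move=> neq.
(* The character takes values in [K^o], the field as an algebra over itself, and is 1 at the index
   (i, j) only. *)
pose v (p : tri_index n) : K^o := (val p == (i, j))%:R.
(* The disjunction says that the two index pairs differ, so at least one factor is sent to 0. Each
   relation supplies one of the strict inequalities, and both its sides vanish. *)
have F0 (a b c d : 'I_n) (ab : (a <= b)%N) (cd : (c <= d)%N) :
    [|| a < c, c < a, b < d | d < b]%N ->
    free_lift v (tri_var K ab * tri_var K cd) = 0.
  move=> neq'; rewrite rmorphM /= !free_lift_tri_var /v /=.
  have [e|] := eqVneq (a, b) (i, j); last by rewrite mul0r.
  have /negPf -> : (c, d) != (i, j); last by rewrite mulr0.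
  by rewrite -e eq_sym xpair_eqE negb_and -!val_eqE !neq_ltn -orbA.
have F0Z e (a b c d : 'I_n) (ab : (a <= b)%N) (cd : (c <= d)%N) :
    [|| a < c, c < a, b < d | d < b]%N ->
    free_lift v (e *: (tri_var K ab * tri_var K cd)) = 0.
  by move=> neq'; rewrite linearZ /= F0 ?scaler0.
have [|chi chiE] := @tri_alg_lift K n q K^o v.
  by move=> x y; case=> [? ? ? ? ? lt|? ? ? ? ? lt|? ? ? ? ? ? lt _|
    ? ? ? ? ? ? lt _]; rewrite [LHS]F0 ?lt ?orbT //
    ?[RHS]F0Z ?[RHS]F0 // lt ?orbT.
apply/eqP => /(congr1 chi)/eqP.
by rewrite !chiE /v /= eqxx [_ == (i, j)]eq_sym (negPf neq) oner_eq0.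
Qed.

Theorem proposition2p3 (K : fieldType) (char_neq2 : 2%N \notin [pchar K])
    (n : nat) (n_ge2 : (2 <= n)%N) (q : K) (q_neq0 : q != 0) :
  exists rho : {lrmorphism tri_alg n q -> tri_alg n q},
    [/\ forall (i j : 'I_n) (le_ij : (i <= j)%N),
          rho (tri_gen q le_ij) = tri_gen q (rev_ord_le le_ij),
        (forall rho' : {lrmorphism tri_alg n q -> tri_alg n q},
          (forall (i j : 'I_n) (le_ij : (i <= j)%N),
             rho' (tri_gen q le_ij) = tri_gen q (rev_ord_le le_ij)) ->
          rho' =1 rho),
        bijective rho
      & has_order rho 2].
Proof.
pose v (p : tri_index n) : tri_alg n q := tri_gen q (rev_ord_le (valP p)).
have rel_pi x y : tri_rel q x y -> tri_pi q x = tri_pi q y.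
  by move=> xy; apply/tri_pi_eq/ideal_gen_rel.
(* A generator carries a proof of its index inequality; this lets different proofs be
   interchanged. *)
have genE (i j : 'I_n) (le1 le2 : (i <= j)%N) : tri_gen q le1 = tri_gen q le2.
  by rewrite (bool_irrelevance le1 le2).
have rev_lt (i j : 'I_n) : (i < j)%N -> (rev_ord j < rev_ord i)%N.
  by move=> ij; apply: ltn_sub2l => //; apply: leq_ltn_trans (ltn_ord j).
have liftM (i j k l : 'I_n) (ij : (i <= j)%N) (kl : (k <= l)%N) :
    free_lift v (tri_var K ij * tri_var K kl) =
    tri_pi q (tri_var K (rev_ord_le ij) * tri_var K (rev_ord_le kl)).
  rewrite !rmorphM /= !free_lift_tri_var.
  by congr (_ * _); apply: genE.
have liftZ c (i j k l : 'I_n) (ij : (i <= j)%N) (kl : (k <= l)%N) :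
    free_lift v (c *: (tri_var K ij * tri_var K kl)) =
    tri_pi q (c *: (tri_var K (rev_ord_le ij) * tri_var K (rev_ord_le kl))).
  by rewrite !linearZ /= liftM.
have [|rho rhoE] := @tri_alg_lift K n q _ v.
  move=> x y; case=> [i j k ik jk ij|j k l jk jl kl|i j k l ik jl ij kl|
    i j k l jk il ij kl]; rewrite [LHS]liftM ?[RHS]liftZ ?[RHS]liftM.
  - exact/rel_pi/tri_rel_row/rev_lt.
  - exact/rel_pi/tri_rel_col/rev_lt.
  (* Reversal turns the smaller index pair into the larger one, so the commutation relation is read
     from right to left. *)
  - by apply/esym/rel_pi/tri_rel_comm; apply: rev_lt.
  - by apply/rel_pi/tri_rel_cross; apply: rev_lt.
have rho_gen (i j : 'I_n) (le_ij : (i <= j)%N) :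
    rho (tri_gen q le_ij) = tri_gen q (rev_ord_le le_ij).
  by rewrite rhoE; apply: genE.
have rhoK : involutive rho.
  apply: (tri_lrmorphism_eq (f := rho \o rho) (g := idfun)) => i j le_ij /=.
  (* The inequality proof is generalized first, so that the doubly reversed indices in its type can
     be rewritten. *)
  rewrite !rho_gen; move: (rev_ord_le _); rewrite !rev_ordK => le_ij'.
  exact: genE.
exists rho; split=> //.
- by move=> rho' rho'E; apply: tri_lrmorphism_eq => i j le_ij; rewrite rho'E.
- by exists rho.
split=> //; case=> [|[|m]] // _.
(* Only the exponent 1 is left to exclude. The index [z] is 0, so the witness is a_11; its image
   a_nn has another index because n is at least 2. *)
pose z := Ordinal (ltnW n_ge2).
move/(_ (tri_gen q (leqnn z)))/eqP; rewrite [iter _ _ _]rho_gen; apply/negP.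
apply: tri_gen_neq; rewrite xpair_eqE -!val_eqE /= andbb.
by rewrite subn_eq0 -ltnNge.
Qed.
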